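(* Let $\mathbf A$ be a set (alphabet), $\mathbb C\langle\mathbf A\rangle$ the unital free associative algebra generated by $\mathbf A$, $\Pi=\sum_{k\ge1}\frac{(-1)^{k-1}}k(\mathrm{Id}-\epsilon)^{*k}$ as in the context, and let $K^{\mathrm{FL}}_n$ be the cumulants associated with the free Lie spreadability system of $\mathbf A$. Then for all $n\ge1$ and $a_1,\dots,a_n\in\mathbf A$, $$\Pi(a_1a_2\cdots a_n)=K_n^{\mathrm{FL}}(a_1,a_2,\dots,a_n).$$
   Context: The map $\Pi$. Let $\mathbf A^*$ be the free monoid on $\mathbf A$ (words), a basis of $\mathbb C\langle\mathbf A\rangle$. Let $\delta_k:\mathbb C\langle\mathbf A\rangle\to\mathbb C\langle\mathbf A\rangle^{\otimes k}$ be the algebra homomorphism with $\delta_k(a)=\sum_{i=1}^k1^{\otimes(i-1)}\otimes a\otimes1^{\otimes(k-i)}$ for $a\in\mathbf A$, and $\mathrm{conc}_k(w_1\otimes\cdots\otimes w_k)=w_1\cdots w_k$. For linear endomorphisms $f_1,\dots,f_k$ of $\mathbb C\langle\mathbf A\rangle$ the convolution is $f_1*\cdots*f_k=\mathrm{conc}_k\circ(f_1\otimes\cdots\otimes f_k)\circ\delta_k$. The counit $\epsilon$ is the linear map with $\epsilon(1)=1$, $\epsilon(w)=0$ for nonempty words $w$, regarded as an endomorphism of $\mathbb C\langle\mathbf A\rangle$. $\Pi:\mathbb C\langle\mathbf A\rangle\to\mathbb C\langle\mathbf A\rangle$ is $\Pi=\sum_{k=1}^\infty\frac{(-1)^{k-1}}k(\mathrm{Id}-\epsilon)^{*k}$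 (on each word only finitely many terms are nonzero). Free Lie spreadability system (for $\mathcal A=\mathbb C\langle\mathbf A\rangle$). $\varphi=\mathrm{Id}:\mathcal A\to\mathcal A$, $\mathcal U=\bigotimes_{i=1}^\infty\mathcal A$ (algebraic infinite tensor product of unital algebras), $\iota^{(j)}(X)=X^{(j)}=1^{\otimes(j-1)}\otimes X\otimes1^{\otimes\infty}$, $\tilde\varphi:\mathcal U\to\mathcal A$ linear with $\tilde\varphi(X_1\otimes\cdots\otimes X_k\otimes1^{\otimes\infty})=X_1\cdots X_k$. Cumulants. For $X_1,\dots,X_n\in\mathcal A$ and $N\in\mathbb N$, $\tilde\varphi\big((\sum_{i=1}^NX_1^{(i)})\cdots(\sum_{i=1}^NX_n^{(i)})\big)$ is a polynomial in $N$ with coefficients in $\mathcal A$; the cumulant $K_n^{\mathrm{FL}}(X_1,\dots,X_n)$ is the coefficient of $N$ in it. *)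

(* Defs.v *)
From HB Require Import structures.
From mathcomp Require Import all_boot all_order all_algebra finmap.
From mathcomp Require Import mathcomp_extra boolp classical_sets functions.
From mathcomp Require Import cardinality fsbigop reals.
From mathcomp Require Import complex monalg.

Set Implicit Arguments.
Unset Strict Implicit.
Unset Printing Implicit Defensive.

Import GRing.Theory.

Local Open Scope fset_scope.
Local Open Scope ring_scope.

(* Restricted direct power of a monoid: finitely supported families.  Since the
   monoid algebra of a direct sum of monoids is the tensor product of the
   monoid algebras, {malg K[mpow I {fmonom A}]} is the tensor power of the free
   algebra {malg K[{fmonom A}]} indexed by I: the k-fold one when I := 'I_k, the
   infinite one (of unital algebras) when I := nat. *)
Definition mpow (I : choiceType) (M : monomType) := {fsfun I -> M with mone}.

Section MonoidPower.
Context (I : choiceType) (M : monomType).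
Implicit Types (W : mpow I M).

HB.instance Definition _ := Choice.on (mpow I M).

Definition mpow_one : mpow I M := [fsfun].
Definition mpow_mul W1 W2 : mpow I M :=
  [fsfun i in finsupp W1 `|` finsupp W2 => mmul (W1 i) (W2 i)].

Lemma mpow_oneE i : mpow_one i = mone. Proof. by rewrite fsfunE. Qed.

Lemma mpow_mulE W1 W2 i : mpow_mul W1 W2 i = mmul (W1 i) (W2 i).
Proof.
rewrite fsfunE in_fsetU; case: ifP => // /negbT; rewrite negb_or !memNfinsupp.
by move=> /andP[/eqP -> /eqP ->]; rewrite mulm1.
Qed.

Lemma mpow_mulA : associative mpow_mul.
Proof. by move=> x y z; apply/fsfunP => i; rewrite !mpow_mulE mulmA. Qed.
Lemma mpow_mul1m : left_id mpow_one mpow_mul.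
Proof. by move=> x; apply/fsfunP => i; rewrite mpow_mulE mpow_oneE mul1m. Qed.
Lemma mpow_mulm1 : right_id mpow_one mpow_mul.
Proof. by move=> x; apply/fsfunP => i; rewrite mpow_mulE mpow_oneE mulm1. Qed.
Lemma mpow_unitm W1 W2 :
  mpow_mul W1 W2 = mpow_one -> W1 = mpow_one /\ W2 = mpow_one.
Proof.
move=> /fsfunP e; have {}e i : W1 i = mone /\ W2 i = mone.
  by apply: unitm; rewrite -mpow_mulE e mpow_oneE.
by split; apply/fsfunP => i; rewrite mpow_oneE; have [] := e i.
Qed.

HB.instance Definition _ := Choice_isMonomialDef.Build (mpow I M)
  mpow_mulA mpow_mul1m mpow_mulm1 mpow_unitm.

Definition mpow_at (i : I) (m : M) : mpow I M := [fsfun j in [fset i] => m].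

End MonoidPower.

Section LinearExtension.
Context (K : fieldType) (M : choiceType) (V : lmodType K) (f : M -> V).

Definition linext (g : {malg K[M]}) : V := \sum_(m <- msupp g) g@_m *: f m.

Lemma linextEw (d : {fset M}) g :
  msupp g `<=` d -> linext g = \sum_(m <- d) g@_m *: f m.
Proof.
move=> le; rewrite /linext (big_fset_incl _ le) //= => m _ /mcoeff_outdom ->.
by rewrite scale0r.
Qed.

Lemma linext_is_linear : linear linext.
Proof.
move=> c g1 g2; pose d := msupp g1 `|` msupp g2 `|` msupp (c *: g1 + g2).
rewrite !(@linextEw d) ?fsubsetUr //; last first.
- by rewrite /d -fsetUA fsubsetUl.
- by rewrite /d fsetUAC fsubsetUr.
rewrite scaler_sumr -big_split; apply: eq_bigr => m _ /=.
by rewrite mcoeffD mcoeffZ scalerDl scalerA.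
Qed.
HB.instance Definition _ :=
  GRing.isLinear.Build K {malg K[M]} V *:%R linext linext_is_linear.

Lemma linextU m : linext << m >> = f m.
Proof. by rewrite /linext msuppU oner_eq0 big_seq_fset1 mcoeffUU scale1r. Qed.

End LinearExtension.


Section MonoidAlgebra.
Context (K : fieldType) (M : monomType).
Implicit Types (x y : {malg K[M]}).

Lemma malgUM (m1 m2 : M) : << m1 >> * << m2 >> = << mmul m1 m2 >> :> {malg K[M]}.
Proof. by rewrite malgM_def fgmulUU mulr1. Qed.

Lemma malg_prodU I (r : seq I) (P : pred I) (m : I -> M) :
  \prod_(i <- r | P i) << m i >>
    = << \big[mmul/mone]_(i <- r | P i) m i >> :> {malg K[M]}.
Proof. by rewrite (big_morph (fun m => << m >>) (fun m1 m2 => esym (malgUM m1 m2)) (erefl _)). Qed.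

Lemma malg_scalerAr (c : K) x y : x * (c *: y) = c *: (x * y).
Proof.
have UZ z m : << z *g m >> = z *: << m >> :> {malg K[M]}.
  by apply/malgP => k; rewrite mcoeffZ !mcoeffU mulr_natr.
rewrite (monalgE x) !mulr_suml scaler_sumr; apply: eq_bigr => m1 _.
rewrite (monalgE y) scaler_sumr !mulr_sumr scaler_sumr.
apply: eq_bigr => m2 _.
have UM a b : << a *g m1 >> * << b *g m2 >> = (a * b) *: << mmul m1 m2 >>
    :> {malg K[M]} by rewrite malgM_def fgmulUU UZ.
by rewrite (UZ y@_m2) scalerA -!UZ !UM scalerA mulrCA.
Qed.

End MonoidAlgebra.

Notation freeAlg K A := {malg K[{fmonom A}]}.
Notation tensPow K A I := {malg K[mpow I {fmonom A}]}.

Section Tensors.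
Context (K : fieldType) (A : choiceType).
Local Notation FA := (freeAlg K A).

Definition letter (a : A) : FA := << fmu a >>.

Section Legs.
Context (I : choiceType).

(* x |-> 1 (x) ... (x) 1 (x) x (x) 1 (x) ..., with x at position i *)
Definition leg (i : I) : FA -> tensPow K A I :=
  linext (fun w : {fmonom A} => << mpow_at i w >>).
HB.instance Definition _ i := GRing.Linear.on (leg i).

End Legs.

(* x_1 (x) ... (x) x_k *)
Definition pureTens k (x : 'I_k -> FA) : tensPow K A 'I_k :=
  \prod_(i < k) leg i (x i).

Definition coprod k : FA -> tensPow K A 'I_k :=
  linext (fun w : {fmonom A} =>
    \prod_(a <- (w : seq A)) \sum_(i < k) leg i (letter a)).
HB.instance Definition _ k := GRing.Linear.on (coprod k).

Definition conc k : tensPow K A 'I_k -> FA :=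
  linext (fun W : mpow 'I_k {fmonom A} => << \big[mmul/mone]_(i < k) W i >>).
HB.instance Definition _ k := GRing.Linear.on (@conc k).

Definition tensMap k (f : 'I_k -> {linear FA -> FA}) :
    tensPow K A 'I_k -> tensPow K A 'I_k :=
  linext (fun W : mpow 'I_k {fmonom A} =>
    pureTens (fun i => f i << W i >>)).
HB.instance Definition _ k f := GRing.Linear.on (@tensMap k f).

Definition convol k (f : 'I_k -> {linear FA -> FA}) : FA -> FA :=
  @conc k \o tensMap f \o coprod k.
HB.instance Definition _ k f := GRing.Linear.on (@convol k f).

Definition counit : FA -> FA :=
  linext (fun w : {fmonom A} => if w == mone then 1 else 0).
HB.instance Definition _ := GRing.Linear.on counit.

(* (Id - epsilon)^{*k} *)
Definition convolIdSubCounit k : FA -> FA :=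
  convol (fun _ : 'I_k => idfun \- counit : {linear FA -> FA}).
HB.instance Definition _ k := GRing.Linear.on (convolIdSubCounit k).

(* This sum over an infinite index set has finitely many nonzero terms: see
   [finite_PiMap] below. *)
Definition PiMap (x : FA) : FA :=
  \sum_(k \in [set k | (1 <= k)%N])
    ((-1) ^+ k.-1 / k%:R) *: convolIdSubCounit k x.

(* the map  X_1 (x) ... (x) X_k (x) 1 (x) ... |-> X_1 ... X_k *)
Definition tphi : tensPow K A nat -> FA :=
  linext (fun W : mpow nat {fmonom A} =>
    << \big[mmul/mone]_(i < \max_(j <- finsupp W) j.+1) W i >>).
HB.instance Definition _ := GRing.Linear.on tphi.

Section TensorTheory.

Lemma mpow_atE (I : choiceType) (M : monomType) (i j : I) (m : M) :
  mpow_at i m j = if j == i then m else mone.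
Proof. by rewrite fsfunE in_fset1. Qed.

Lemma mpow_bigE (I : choiceType) (M : monomType) T (r : seq T)
    (W : T -> mpow I M) i :
  (\big[mmul/mone]_(t <- r) W t) i = \big[mmul/mone]_(t <- r) W t i.
Proof.
apply: (big_morph (fun W : mpow I M => W i)); last exact: mpow_oneE.
by move=> W1 W2; exact: mpow_mulE.
Qed.

Lemma letterM (s : seq A) :
  \prod_(a <- s) letter a = << FMonom s >> :> FA.
Proof.
rewrite malg_prodU; congr (<< _ >>); elim: s => [|a s IHs].
  by rewrite big_nil -fmoneE.
by rewrite big_cons IHs -[mmul _ _]/(fmmul _ _) fmmulE fmuE.
Qed.

Lemma leg1 (I : choiceType) (i : I) : leg i 1 = 1.
Proof.
rewrite [LHS]linextU; congr (<< _ >>); apply/fsfunP => j.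
by rewrite mpow_atE mpow_oneE if_same.
Qed.

Lemma linext_mul (M : monomType) (L : lalgType K) (f : M -> L) :
    (forall (c : K) (u v : L), u * (c *: v) = c *: (u * v)) ->
    (forall m1 m2, f (mmul m1 m2) = f m1 * f m2) ->
  {morph linext f : x y / x * y}.
Proof.
move=> LA fM x y; have UZ z (m : M) : << z *g m >> = z *: << m >> :> {malg K[M]}.
  by apply/malgP => k; rewrite mcoeffZ !mcoeffU mulr_natr.
rewrite {1}(monalgE x) mulr_suml linear_sum [in RHS]/linext mulr_suml.
apply: eq_bigr => m1 _.
rewrite {1}(monalgE y) mulr_sumr linear_sum mulr_sumr.
apply: eq_bigr => m2 _.
rewrite (UZ x@_m1) (UZ y@_m2) malg_scalerAr -!scalerAl !linearZ /= malgUM linextU fM.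
by rewrite LA !scalerA mulrC.
Qed.

Lemma legM (I : choiceType) (i : I) : {morph leg i : x y / x * y}.
Proof.
apply: linext_mul => [|w1 w2]; first exact: malg_scalerAr.
rewrite malgUM; congr (<< _ >>); apply/fsfunP => j.
by rewrite [RHS]mpow_mulE !mpow_atE; case: ifP => // _; rewrite mulm1.
Qed.

Lemma coprod1 k : coprod k 1 = 1.
Proof. by rewrite [LHS]linextU /mone /= fmoneE big_nil. Qed.

Lemma coprodM k : {morph coprod k : x y / x * y}.
Proof.
apply: linext_mul => [|w1 w2]; first exact: malg_scalerAr.
by rewrite -[mmul _ _]/(fmmul _ _) fmmulE big_cat.
Qed.

Lemma coprod_letter k a : coprod k (letter a) = \sum_(i < k) leg i (letter a).
Proof. by rewrite [LHS]linextU fmuE big_seq1. Qed.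

Lemma prod_scale (M : monomType) T (r : seq T) (c : T -> K)
    (x : T -> {malg K[M]}) :
  \prod_(t <- r) (c t *: x t) = (\prod_(t <- r) c t) *: \prod_(t <- r) x t.
Proof.
elim: r => [|t r IHr]; first by rewrite !big_nil scale1r.
by rewrite !big_cons IHr malg_scalerAr -scalerAl scalerA mulrC.
Qed.

Lemma prod_expand (M : monomType) k (g : 'I_k -> {linear FA -> {malg K[M]}})
    (x : 'I_k -> FA) (d : {fset {fmonom A}}) :
    (forall i, msupp (x i) `<=` d) ->
  \prod_(i < k) g i (x i) =
    \sum_(f : {ffun 'I_k -> d}) (\prod_(i < k) (x i)@_(val (f i))) *:
       \prod_(i < k) g i << val (f i) >>.
Proof.
move=> xd; have UZ z (m : {fmonom A}) : << z *g m >> = z *: << m >> :> FA.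
  by apply/malgP => w; rewrite mcoeffZ !mcoeffU mulr_natr.
under eq_bigr => i _.
  rewrite (monalgEw (xd i)) big_seq_fsetE linear_sum /=.
  under eq_bigr => j _ do rewrite (UZ (x i)@_(val j)) linearZ /=.
over.
by rewrite bigA_distr_bigA; apply: eq_bigr => f _; rewrite prod_scale.
Qed.

Lemma msupp_bound k (x : 'I_k -> FA) :
  exists d : {fset {fmonom A}}, forall i, msupp (x i) `<=` d.
Proof.
exists [fset w in flatten [seq enum_fset (msupp (x i)) | i <- enum 'I_k]] => i.
apply/fsubsetP => w wi; rewrite in_fset; apply/flattenP.
by exists (enum_fset (msupp (x i))) => //; apply/mapP; exists i; rewrite ?mem_enum.
Qed.

Lemma prod_legU (I : choiceType) k (h : 'I_k -> I) (w : 'I_k -> {fmonom A}) :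
  \prod_(i < k) leg (h i) << w i >> =
    << \big[mmul/mone]_(i < k) mpow_at (h i) (w i) >>.
Proof. by rewrite -malg_prodU; apply: eq_bigr => j _; rewrite [LHS]linextU. Qed.

Lemma big_mpow_at (I : choiceType) k (h : 'I_k -> I) (w : 'I_k -> {fmonom A}) i :
  injective h -> (\big[mmul/mone]_(j < k) mpow_at (h j) (w j)) (h i) = w i.
Proof.
move=> h_inj; rewrite mpow_bigE.
under eq_bigr do rewrite mpow_atE (inj_eq h_inj) eq_sym.
by rewrite -big_mkcond /= big_pred1_eq.
Qed.

Lemma pureTensU k (w : 'I_k -> {fmonom A}) :
  exists2 W : mpow 'I_k {fmonom A},
    pureTens (fun i => << w i >>) = << W >> & forall i, W i = w i.
Proof.
exists (\big[mmul/mone]_(i < k) mpow_at i (w i)) => [|i].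
  exact: (prod_legU id).
exact: (big_mpow_at (h := id)).
Qed.

Lemma conc_pureTens k (x : 'I_k -> FA) : conc (pureTens x) = \prod_(i < k) x i.
Proof.
have [d xd] := msupp_bound x.
rewrite [pureTens x](prod_expand (fun i => leg i) xd).
rewrite [RHS](prod_expand (fun i => idfun : {linear FA -> FA}) xd) linear_sum.
apply: eq_bigr => f _; rewrite linearZ; congr (_ *: _).
have [W WE Wf] := pureTensU (fun i => val (f i)).
rewrite -[LHS]/(conc (pureTens (fun i => << val (f i) >>))) WE [LHS]linextU malg_prodU.
by congr (<< _ >>); apply: eq_bigr => i _; rewrite Wf.
Qed.

Lemma tensMap_pureTens k (f : 'I_k -> {linear FA -> FA}) (x : 'I_k -> FA) :
  tensMap f (pureTens x) = pureTens (fun i => f i (x i)).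
Proof.
have [d xd] := msupp_bound x.
rewrite [pureTens x](prod_expand (fun i => leg i) xd).
rewrite [RHS](prod_expand (fun i => leg i \o f i : {linear _ -> _}) xd).
rewrite linear_sum; apply: eq_bigr => h _; rewrite linearZ; congr (_ *: _).
have [W WE Wf] := pureTensU (fun i => val (h i)).
rewrite -[LHS]/(tensMap f (pureTens (fun i => << val (h i) >>))) WE [LHS]linextU.
by apply: eq_bigr => i _; rewrite Wf.
Qed.

Lemma tphi_prod_leg k (x : 'I_k -> FA) :
  tphi (\prod_(i < k) leg (val i) (x i)) = \prod_(i < k) x i.
Proof.
have [d xd] := msupp_bound x.
rewrite (prod_expand (fun i => leg (val i)) xd).
rewrite [RHS](prod_expand (fun i => idfun : {linear FA -> FA}) xd) linear_sum.
apply: eq_bigr => f _; rewrite linearZ; congr (_ *: _).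
rewrite (prod_legU val) [LHS]linextU malg_prodU; congr (<< _ >>).
set W := (X in finsupp X); set m := \max_(_ <- _) _.
have WE i : W (val i) = val (f i) by apply: big_mpow_at; exact: val_inj.
have Wk j : (k <= j)%N -> W j = mone.
  move=> kj; rewrite mpow_bigE big1 // => i _; rewrite mpow_atE.
  by case: eqP => // e; move: kj; rewrite e leqNgt ltn_ord.
have Wm j : (m <= j)%N -> W j = mone.
  move=> mj; apply/eqP; rewrite -memNfinsupp; apply/negP => jW.
  have: (j < m)%N by apply: (@leq_bigmax_seq _ _ xpredT (fun j => j.+1)).
  by rewrite ltnNge mj.
have trunc p q : (p <= q)%N -> (forall j, (p <= j)%N -> W j = mone) ->
    \big[mmul/mone]_(i < p) W i = \big[mmul/mone]_(i < q) W i.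
  move=> pq Wp; rewrite -!(big_mkord xpredT (fun i => W i)).
  rewrite [RHS](big_cat_nat (n := p)) //= [X in mmul _ X]big1_seq ?mulm1 //.
  by move=> j; rewrite mem_index_iota => /andP[_ /andP[pj _]]; exact: Wp.
transitivity (\big[mmul/mone]_(i < k) W i); last first.
  by apply: eq_bigr => i _; exact: WE.
by case: (leqP m k) => [mk|/ltnW km]; [exact: trunc | rewrite -(trunc k m)].
Qed.

Lemma convolIdSubCounit_eq0 k (w : {fmonom A}) :
  (size w < k)%N -> convolIdSubCounit k << w >> = 0.
Proof.
move=> wk; rewrite /convolIdSubCounit /convol /= [coprod _ _]linextU.
case: w wk => s /= sk.
rewrite (big_tnth _ _ s) bigA_distr_bigA [tensMap _ _]linear_sum linear_sum.
rewrite big1 // => f _.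
have -> : \prod_(j < size s) leg (f j) (letter (tnth (in_tuple s) j)) =
    << \big[mmul/mone]_(j < size s) mpow_at (f j) (fmu (tnth (in_tuple s) j)) >>.
  by rewrite -malg_prodU; apply: eq_bigr => j _; rewrite [LHS]linextU.
set W := (X in << X >>); have [i fi] : exists i, i \notin codom f.
  case: (pickP (fun i => i \notin codom f)) => [i fi|cf]; first by exists i.
  have : (#|codom f| <= #|'I_(size s)|)%N by exact: fintype.leq_image_card.
  rewrite card_ord leqNgt; suff -> : #|codom f| = k by rewrite sk.
  rewrite -[RHS](card_ord k); apply: eq_card => i; rewrite !inE.
  by have /negbFE := cf i.
pose g (_ : 'I_k) : {linear FA -> FA} := idfun \- @counit.
have Wi : W i = mone.
  rewrite /W mpow_bigE big1 // => j _; rewrite mpow_atE.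
  by case: eqP => // e; move: fi; rewrite e codom_f.
have TW : tensMap g << W >> = 0.
  rewrite [LHS]linextU /pureTens.
  have [r1 [r2 ->]] : exists r1 r2, index_enum 'I_k = r1 ++ i :: r2.
    by case/splitPr: (mem_index_enum i) => r1 r2; exists r1, r2.
  rewrite big_cat big_cons /= Wi [counit _]linextU eqxx subrr linear0.
  by rewrite mul0r mulr0.
by transitivity (conc (tensMap g << W >>)) => //; rewrite TW linear0.
Qed.

Lemma finite_PiMap (x : FA) :
  finite_set [set k | convolIdSubCounit k x != 0].
Proof.
pose m := \max_(w <- msupp x) (size w).+1.
apply: (sub_finite_set _ (finite_II m)) => k /=; apply: contraNT.
rewrite -leqNgt => mk; rewrite (monalgE x) linear_sum big1_seq //= => w wx.
have UZ z : << z *g w >> = z *: << w >> :> FA.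
  by apply/malgP => v; rewrite mcoeffZ !mcoeffU mulr_natr.
rewrite UZ linearZ /= convolIdSubCounit_eq0 ?scaler0 //.
by apply: leq_trans mk; apply: (@leq_bigmax_seq _ _ xpredT
  (fun w : {fmonom A} => (size w).+1)).
Qed.

End TensorTheory.

End Tensors.

Section Cumulants.
Context (K : fieldType) (B U : lalgType K) (iota : nat -> B -> U) (phi : U -> B).

Definition momentSum n (X : 'I_n -> B) (N : nat) : B :=
  phi (\prod_(j < n) \sum_(i < N) iota i (X j)).

(* The coefficient of N in the polynomial [momentSum X N]; the polynomial is
   determined by its values at the natural numbers in characteristic 0. *)
Definition cumulant n (X : 'I_n -> B) : B :=
  (xget 0 [set p : {poly B} | forall N : nat, p.[N%:R] = momentSum X N])`_1.

End Cumulants.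

Definition freeLieCumulant (K : fieldType) (A : choiceType) n
    (X : 'I_n -> freeAlg K A) : freeAlg K A :=
  cumulant (@leg K A nat) (@tphi K A) X.

(* Main.v *)
Require Import Defs.
From mathcomp Require Import finmap classical_sets cardinality fsbigop.
From mathcomp Require Import all_boot all_order all_algebra.
From mathcomp Require Import reals complex monalg.

(** Write the letters a_1, ..., a_n and call a map f : [n] -> [N] a labelling.
    Grouping the letters by label, and keeping their order within each label,
    gives a word [fiberProd f], the product over i of the words read along the
    fibers f^-1(i).  Both sides of the theorem are sums of such words.

    Expanding the product of sums, the moment with N summands is the sum of
    [fiberProd f] over all f : [n] -> [N] ([momentSum_letters]).  On the other
    hand, the unshuffle coproduct distributes the letters over k tensor legs
    in all possible ways, and Id - epsilon kills a leg exactly when it is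
    empty; so (Id - epsilon)^{*k} (a_1 ... a_n) is the same sum restricted to
    the surjective labellings f : [n] -> [k] ([convolIdSubCounit_letters]).
    Call it E_k, or [surjSum k].

    Every labelling is surjective onto its image S, a subset of [N], and the
    increasing bijection of S with [#|S|] does not change [fiberProd].  Hence
    the moment equals sum_k C(N, k) E_k ([sum_fiberProd]), which is the
    expansion of Id^{*N} = (epsilon + (Id - epsilon))^{*N}.  It is a polynomial
    in N, and the coefficient of N in C(N, k) = N (N - 1) ... (N - k + 1) / k!
    is (-1)^(k - 1) / k for k >= 1 ([coef1_binomPoly]).  Reading off the
    coefficient of N gives exactly the series that defines Pi.  The cumulant is
    defined through any polynomial that takes the values of the moments, so one
    also needs that such a polynomial is unique ([malg_poly_nat_inj]). *)

Set Implicit Arguments.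
Unset Strict Implicit.
Unset Printing Implicit Defensive.

Import GRing.Theory Num.Theory.

Local Open Scope ring_scope.

(** * Coefficients of polynomials determined by their values at the naturals *)

Section PolynomialValues.
Context (K : fieldType) (charK : [pchar K] =i pred0).

Let natK_eq0 i : (i%:R == 0 :> K) = (i == 0)%N.
Proof. exact: (pcharf0P K).1. Qed.

Lemma poly_nat_roots (p : {poly K}) : (forall N : nat, p.[N%:R] = 0) -> p = 0.
Proof.
move=> p0; apply/eqP; apply: contraT => pN0.
pose rs : seq K := [seq i%:R | i <- iota 0 (size p)].
have: (size rs < size p)%N.
  apply: (max_poly_roots pN0).
    by apply/allP => x /mapP[i _ ->]; apply/eqP; exact: p0.
  rewrite map_inj_in_uniq ?iota_uniq // => i j _ _ /eqP.
  wlog ij : i j / (i <= j)%N => [th|].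
    by case: (leqP i j) => [/th //|/ltnW ji]; rewrite eq_sym => /(th _ _ ji).
  rewrite eq_sym -subr_eq0 -natrB // natK_eq0 subn_eq0 => ji.
  by apply/eqP; rewrite eqn_leq ij ji.
by rewrite size_map size_iota ltnn.
Qed.

(** The monoid algebra need not be commutative nor have inverses, so the bound
    on the number of roots is applied to each scalar coordinate [mcoeff m];
    this works because the values N%:R come from the base field. *)
Lemma malg_poly_nat_inj (M : monomType) (p q : {poly {malg K[M]}}) :
  (forall N : nat, p.[N%:R] = q.[N%:R]) -> p = q.
Proof.
move=> pq; apply/eqP; rewrite -subr_eq0; apply/eqP.
have {pq} : forall N : nat, (p - q).[N%:R] = 0.
  by move=> N; rewrite hornerD hornerN pq subrr.
move: (p - q) => r r0; apply/polyP => i; rewrite coef0; apply/malgP => m.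
rewrite mcoeff0.
have: map_poly (mcoeff m) r = 0.
  apply: poly_nat_roots => N; transitivity (mcoeff m r.[N%:R]); last first.
    by rewrite r0 mcoeff0.
  rewrite (horner_coef_wide _ (size_poly _ _)) horner_coef linear_sum /=.
  apply: eq_bigr => j _; rewrite coef_map /= -!natrX !mulr_natr.
  by rewrite -mcoeffMn.
by move=> /polyP/(_ i); rewrite coef_map coef0.
Qed.

Definition binomPoly k : {poly K} :=
  (k`!%:R)^-1 *: \prod_(i < k) ('X - i%:R%:P).

Lemma horner_binomPoly k N : (binomPoly k).[N%:R] = 'C(N, k)%:R.
Proof.
have fk : k`!%:R != 0 :> K by rewrite natK_eq0 -lt0n fact_gt0.
apply: (mulfI fk); rewrite hornerZ mulVKf // -natrM mulnC bin_ffact horner_prod.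
elim: k {fk} => [|k IHk]; first by rewrite big_ord0 ffactn0.
rewrite big_ord_recr /= IHk hornerXsubC ffactnSr natrM.
have [kN|Nk] := leqP k N; first by rewrite natrB.
by rewrite ffact_small // !mul0r.
Qed.

Lemma coef1_binomPoly k :
  (0 < k)%N -> (binomPoly k)`_1 = (-1) ^+ k.-1 / k%:R.
Proof.
case: k => // k _; rewrite /binomPoly coefZ big_ord_recl subr0 coefXM /=.
rewrite -horner_coef0 horner_prod.
under eq_bigr => i _ do rewrite hornerXsubC sub0r.
rewrite prodrN card_ord -natr_prod.
have -> : (\prod_(i < k) lift ord0 i = k`!)%N by rewrite fact_prod big_add1 big_mkord.
have fk : k`!%:R != 0 :> K by rewrite natK_eq0 -lt0n fact_gt0.
by rewrite factS natrM invfM mulrC -mulrA [_^-1 * _^-1]mulrC mulVKf.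
Qed.

End PolynomialValues.

(** * Words attached to labellings of the letters *)

Section Fibers.
Context (K : fieldType) (A : choiceType) (n : nat) (a : 'I_n -> A).
Local Notation FA := (freeAlg K A).

(** The index type is not restricted to ordinals because the same words occur
    on the legs of the finite and of the infinite tensor power. *)
Definition fiberWord (I : eqType) (f : 'I_n -> I) (i : I) : {fmonom A} :=
  \big[mmul/mone]_(j < n) (if i == f j then fmu (a j) else mone).

Definition fiberProd N (f : 'I_n -> 'I_N) : FA :=
  << \big[mmul/mone]_(i < N) fiberWord f i >>.

Definition surjSum k : FA :=
  \sum_(f : {ffun 'I_n -> 'I_k} | f @: [set: 'I_n] == [set: 'I_k]%SET) fiberProd f.

Lemma fiberWord_eq1 (I : eqType) (f : 'I_n -> I) i :
  (fiberWord f i == mone) = [forall j, i != f j].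
Proof.
apply/eqP/forallP => [e j|fi]; last first.
  by rewrite /fiberWord big1 // => j _; rewrite (negPf (fi j)).
have : forall r, j \in r -> 
   \big[mmul/mone]_(j <- r) (if i == f j then fmu (a j) else mone) = mone ->
   (if i == f j then fmu (a j) else mone) = mone.
  elim=> // t r IHr; rewrite inE big_cons => /orP[/eqP <- /unitm[] //|jr].
  by case/unitm => _ /IHr; exact.
move=> /(_ _ (mem_index_enum j) e); case: (i == f j) => //.
by rewrite fmuE /mone /= fmoneE => /(congr1 (fun w : {fmonom A} => size w)).
Qed.

(** Letters on different legs commute, those on the same leg keep their order:
    this is where an arbitrary labelling turns into a product of fibers taken
    in the order of the labels.  The reindexing h is the identity for the k-fold
    tensor power and the inclusion of [N] into nat for the infinite one. *)
Lemma prod_leg_fiberWord (I : choiceType) (f : 'I_n -> I) N (h : 'I_N -> I) :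
    injective h -> (forall j, f j \in codom h) ->
  \prod_(j < n) leg (f j) (letter K (a j)) =
    \prod_(i < N) leg (h i) << fiberWord f (h i) >> :> tensPow K A I.
Proof.
move=> h_inj fh; rewrite !prod_legU; congr (<< _ >>).
apply/fsfunP => i.
rewrite mpow_bigE; under eq_bigr do rewrite mpow_atE.
rewrite -/(fiberWord f i).
have [/codomP[t ->]|ih] := boolP (i \in codom h); first by rewrite big_mpow_at.
transitivity (mone : {fmonom A}).
  apply/eqP; rewrite fiberWord_eq1; apply/forallP => j.
  by apply: contraNneq ih => ->.
rewrite mpow_bigE big1 // => t _; rewrite mpow_atE; case: eqP => // e.
by rewrite e codom_f in ih.
Qed.

(** * The two sides as sums over labellings *)

Lemma momentSum_letters N :
  momentSum (@leg K A nat) (@tphi K A) (fun j => letter K (a j)) N =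
    \sum_(f : {ffun 'I_n -> 'I_N}) fiberProd f.
Proof.
rewrite /momentSum bigA_distr_bigA linear_sum; apply: eq_bigr => f _.
rewrite (@prod_leg_fiberWord _ _ N val) => [|//|j]; last 2 first.
- exact: val_inj.
- exact: codom_f.
by rewrite [LHS]tphi_prod_leg malg_prodU.
Qed.

Lemma convolIdSubCounit_letters k :
  convolIdSubCounit k (\prod_(j < n) letter K (a j)) = surjSum k.
Proof.
rewrite /convolIdSubCounit /convol /=.
rewrite (big_morph _ (@coprodM K A k) (@coprod1 K A k)).
under eq_bigr do rewrite coprod_letter.
rewrite bigA_distr_bigA [tensMap _ _]linear_sum linear_sum /surjSum [RHS]big_mkcond.
apply: eq_bigr => f _.
rewrite (@prod_leg_fiberWord _ _ k id) => [|//|j]; last by apply/codomP; exists (f j).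
pose g (_ : 'I_k) : {linear FA -> FA} := idfun \- @counit K A.
rewrite -[LHS]/(conc (tensMap g (pureTens (fun i => << fiberWord f i >>)))).
rewrite tensMap_pureTens conc_pureTens.
have gE i (w : {fmonom A}) : g i << w >> = if w == mone then 0 else << w >>.
  rewrite /g /= [counit _]linextU.
  by case: eqP => [->|_]; rewrite ?subrr ?subr0.
under eq_bigr do rewrite gE.
case: ifP => [/eqP fT|/negbT fNT].
  rewrite /fiberProd -malg_prodU; apply: eq_bigr => i _.
  rewrite fiberWord_eq1; case: forallP => // fi.
  have: i \in f @: [set: 'I_n] by rewrite fT inE.
  by case/imsetP => j _ ij; have := fi j; rewrite ij eqxx.
have [i fi] : exists i, i \notin f @: [set: 'I_n].
  by move: fNT; rewrite -subTset => /subsetPn[i _ fi]; exists i.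
have [r1 [r2 ->]] : exists r1 r2, index_enum 'I_k = r1 ++ i :: r2.
  by case/splitPr: (mem_index_enum i) => r1 r2; exists r1, r2.
(* The empty fiber over i gives a zero factor. *)
rewrite big_cat big_cons /= fiberWord_eq1; case: forallP => [_|[]].
  by rewrite mul0r mulr0.
by move=> j; apply: contraNneq fi => ->; exact: imset_f.
Qed.

Lemma surjSum_eq0 k : (n < k)%N -> surjSum k = 0.
Proof.
move=> nk; rewrite /surjSum big1 // => f /eqP fT; exfalso.
have := leq_imset_card f [set: 'I_n].
by rewrite fT !cardsT !card_ord leqNgt nk.
Qed.

(** The product is noncommutative, so it matters that [enum_val] lists S in
    increasing order. *)
Lemma big_mone_enum_val (M : monomType) N (S : {set 'I_N}) (m : 'I_N -> M) :
    (forall i, i \notin S -> m i = mone) ->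
  \big[mmul/mone]_(i < N) m i = \big[mmul/mone]_(t < #|S|) m (enum_val t).
Proof.
move=> mS; transitivity (\big[mmul/mone]_(i in S) m i).
  rewrite [RHS]big_mkcond; apply: eq_bigr => i _.
  by case: ifPn => // /mS.
rewrite -big_filter.
have -> : [seq i <- index_enum 'I_N | i \in S] = enum S.
  by rewrite [index_enum _]unlock.
have [S0|[x0 _]] := set_0Vmem S.
  have e0 : enum S = [::] by apply/size0nil; rewrite -cardE S0 cards0.
  rewrite e0 big_nil big1 // => t _.
  by have := enum_valP t; move: (enum_val t) => i; rewrite S0 inE.
rewrite (big_nth x0) big_mkord -cardE; apply: eq_bigr => t _.
by rewrite (enum_val_nth x0).
Qed.

(** * Expansion of the moments over the images of the labellings *)

(** A labelling with image S is a surjection onto [#|S|] followed by the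
    increasing enumeration of S; the labels outside S contribute empty words. *)
Lemma sum_image_eq N (S : {set 'I_N}) :
  \sum_(f : {ffun 'I_n -> 'I_N} | f @: [set: 'I_n] == S) fiberProd f =
    surjSum #|S|.
Proof.
pose up (g : {ffun 'I_n -> 'I_#|S|}) := [ffun j => enum_val (g j)].
have up_inj : injective up.
  move=> g1 g2 /ffunP e; apply/ffunP => j.
  by have := e j; rewrite !ffunE => /enum_val_inj.
have imup g : up g @: [set: 'I_n] = enum_val @: (g @: [set: 'I_n]).
  by rewrite -imset_comp; apply: eq_imset => j; rewrite ffunE.
have imS : enum_val @: [set: 'I_#|S|] = S.
  apply/setP => i; apply/imsetP/idP => [[t _ ->]|iS]; first exact: enum_valP.
  by exists (enum_rank_in iS i); rewrite ?enum_rankK_in.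
have up_im g : (up g @: [set: 'I_n] == S) = (g @: [set: 'I_n] == [set: 'I_#|S|]%SET).
  by rewrite imup -[X in _ == X]imS (inj_eq (imset_inj enum_val_inj)).
(* A preimage of f under up needs f to take values in S, hence the partial
   inverse. *)
rewrite (reindex_omap up (fun f => [pick g | up g == f])) => [|f /eqP fS].
  rewrite /surjSum; apply: eq_big => [g|g].
    rewrite up_im; case: pickP => [g' /eqP/up_inj->|/(_ g)]; rewrite ?eqxx //.
    by rewrite andbT.
  move=> /andP[/eqP gS _]; congr (<< _ >>).
  rewrite (big_mone_enum_val (S := S)) => [|i iS].
    apply: eq_bigr => t _; apply: eq_bigr => j _.
    by rewrite ffunE (inj_eq enum_val_inj).
  apply/eqP; rewrite fiberWord_eq1; apply/forallP => j.
  by apply: contraNneq iS => ->; rewrite -gS imset_f.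
have fjS j : f j \in S by rewrite -fS imset_f.
case: pickP => [g /eqP <- //|].
move/(_ [ffun j => enum_rank_in (fjS j) (f j)])/eqP; case.
by apply/ffunP => j; rewrite !ffunE enum_rankK_in.
Qed.

(** Each k-subset of [N] contributes one copy of E_k.  The bound k <= n, not
    k <= N, makes the right-hand side a polynomial in N; it is enough because
    E_k vanishes for k > n. *)
Lemma sum_fiberProd N :
  \sum_(f : {ffun 'I_n -> 'I_N}) fiberProd f =
    \sum_(k < n.+1) surjSum k *+ 'C(N, k).
Proof.
rewrite (partition_big (fun f : {ffun _} => f @: [set: 'I_n]) xpredT) //=.
under eq_bigr do rewrite sum_image_eq.
rewrite (bigID (fun S : {set 'I_N} => #|S| < n.+1)%N) /= addrC big1 => [|S]; last first.
  by rewrite -leqNgt => /surjSum_eq0.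
rewrite add0r (partition_big (fun S : {set 'I_N} => inord #|S| : 'I_n.+1) xpredT) //=.
apply: eq_bigr => k _.
rewrite -[in 'C(N, k)](card_ord N) -card_draws -sumr_const.
apply: eq_big => [S|S]; rewrite ?inE.
  apply/andP/eqP => [[Sn /eqP <-]|Sk]; first by rewrite inordK.
  by rewrite Sk ltn_ord inord_val.
by case/andP => Sn /eqP <-; rewrite inordK.
Qed.

(** * Comparison of coefficients *)

Lemma cumulant_letters (charK : [pchar K] =i pred0) :
  freeLieCumulant (fun j => letter K (a j)) =
    \sum_(k < n.+1) (binomPoly K k)`_1 *: surjSum k.
Proof.
pose p := \sum_(k < n.+1) \poly_(i < size (binomPoly K k)) ((binomPoly K k)`_i *: surjSum k).
have pE N : p.[N%:R] = momentSum (@leg K A nat) (@tphi K A) (fun j => letter K (a j)) N.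
  rewrite momentSum_letters sum_fiberProd horner_sum; apply: eq_bigr => k _.
  rewrite horner_poly -[RHS]scaler_nat -(horner_binomPoly charK) horner_coef scaler_suml.
  by apply: eq_bigr => i _; rewrite -!natrX !mulr_natr scalerMnl.
rewrite /freeLieCumulant /cumulant (xget_subset1 _ (x := p)) => [||q r qE rE].
- rewrite coef_sum; apply: eq_bigr => k _; rewrite coef_poly; case: ltnP => // k1.
  by rewrite nth_default // scale0r.
- exact: pE.
- by apply: (malg_poly_nat_inj charK) => N; rewrite qE rE.
Qed.

Lemma PiMap_letters :
  PiMap (\prod_(j < n) letter K (a j)) =
    \sum_(k < n) ((-1) ^+ k / k.+1%:R) *: surjSum k.+1.
Proof.
rewrite /PiMap.
transitivity (\sum_(k \in [set` iota 1 n]%classic)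
   ((-1) ^+ k.-1 / k%:R : K) *: convolIdSubCounit k (\prod_(j < n) letter K (a j))).
  apply/esym/fsbig_widen => k /=; rewrite mem_iota; first by case/andP.
  case=> k1 /negP; rewrite k1 /= add1n ltnS -ltnNge => nk.
  by rewrite convolIdSubCounit_letters surjSum_eq0 // scaler0.
rewrite -fsbig_seq ?iota_uniq //.
have -> : iota 1 n = index_iota 1 n.+1 by rewrite /index_iota subn1.
rewrite big_add1 big_mkord.
by apply: eq_bigr => k _; rewrite convolIdSubCounit_letters.
Qed.

End Fibers.

Theorem theorem6p13 (R : realType) (A : choiceType) (n : nat) (hn : (1 <= n)%N)
    (a : 'I_n -> A) :
  PiMap (\prod_(j < n) letter (R[i])%C (a j)) =
  freeLieCumulant (fun j : 'I_n => letter (R[i])%C (a j)).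
Proof.
rewrite PiMap_letters cumulant_letters; last exact: pchar_num.
(* C(N, 0) = 1 has no term linear in N. *)
rewrite big_ord_recl /binomPoly /= big_ord0 coefZ coef1 mulr0 scale0r add0r.
apply: eq_bigr => k _; rewrite coef1_binomPoly //; exact: pchar_num.
Qed.
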